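(* For integers $1\le m\le n$ let $$H_{n,m}(t,u)=\sum_{\substack{\mathbf w\in \mathrm{PF}_n\\ \max_i w_i\le m}} t^{\mathrm{pk}(\mathbf w)}u^{\mathrm{tie}(\mathbf w)}.$$ Then for $2\le m\le n$, $$H_{n,m}(t,u)=H_{n,m-1}(t,u)+\sum_{r=1}^{n-m+1}\bigl(\mathcal I_{n-r,r}H_{n-r,m-1}\bigr)(t,u),$$ with initial condition $H_{n,1}(t,u)=u^{n-1}$, where $\mathcal I_{\ell,r}$ is the insertion operator given by $$\bigl(\mathcal I_{\ell,r}F\bigr)(t,u)=[z^r]\,\mathcal E^2\mathcal A^{\ell-1}F\!\left(\frac{\mathcal B}{\mathcal A^2},\frac{\mathcal C}{\mathcal A}\right),\qquad F\in\mathbb R[t,u],$$ with $$\mathcal E=1+\frac{z}{1-uz},\quad \mathcal A=1+tz+\frac{uz^2}{1-uz},\quad \mathcal C=u+tz+\frac{uz^2}{1-uz},\quad \mathcal B=\mathcal A^2+t-1.$$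
   Context: A parking function of length $n$ is a word $\mathbf w=(w_1,\dots,w_n)\in[n]^n$, $[n]=\{1,\dots,n\}$, whose nondecreasing rearrangement $b_1\le\dots\le b_n$ satisfies $b_i\le i$ for all $i$; $\mathrm{PF}_n$ is the set of these. For a word $\mathbf w$ of length $n$: $\mathrm{tie}(\mathbf w)$ is the number of $i\in[n-1]$ with $w_i=w_{i+1}$; $\mathrm{pk}(\mathbf w)$ is the number of strict peaks, i.e. of indices $2\le i\le n-1$ with $w_{i-1}<w_i>w_{i+1}$. The insertion operator $\mathcal I_{\ell,r}\colon\mathbb R[t,u]\to\mathbb R[t,u]$ is defined for $\ell\ge1$, $r\ge0$. All series are formal power series in $z$ with coefficients in $\mathbb R[t,u]$ ($\mathcal A$ has constant term $1$ in $z$, hence is invertible), and $[z^r]$ extracts the coefficient of $z^r$. *)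

(* Defs.v *)
From HB Require Import structures.
From mathcomp Require Import all_boot all_order all_algebra.
From mathcomp Require Import boolp reals.
From mathcomp Require Import mpoly.

Set Implicit Arguments.
Unset Strict Implicit.
Unset Printing Implicit Defensive.

Import GRing.Theory.
Local Open Scope ring_scope.

(* [mkFps a] is the formal power series \sum_n (a n) z^n.  A record, so that
   the Cauchy product does not clash with the pointwise product of functions. *)
Record fps (K : Type) := mkFps { fcoef : nat -> K }.

Lemma fpsP (K : Type) (f g : fps K) :
  (forall n, fcoef f n = fcoef g n) -> f = g.
Proof. by case: f g => [f] [g] /= /funext ->. Qed.

HB.instance Definition _ (K : Type) := gen_eqMixin (fps K).
HB.instance Definition _ (K : Type) := gen_choiceMixin (fps K).

Section Ring.
Variable K : comNzRingType.
Implicit Types f g h : fps K.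

Definition fps_const (c : K) : fps K := mkFps (fun n => c *+ (n == 0)%N).
Definition fps_opp f : fps K := mkFps (fun n => - fcoef f n).
Definition fps_add f g : fps K := mkFps (fun n => fcoef f n + fcoef g n).
Definition fps_mul f g : fps K :=
  mkFps (fun n => \sum_(i < n.+1) fcoef f i * fcoef g (n - i)%N).

Fact fps_addA : associative fps_add.
Proof. by move=> f g h; apply: fpsP => n /=; rewrite addrA. Qed.
Fact fps_addC : commutative fps_add.
Proof. by move=> f g; apply: fpsP => n /=; rewrite addrC. Qed.
Fact fps_add0 : left_id (fps_const 0) fps_add.
Proof. by move=> f; apply: fpsP => n /=; rewrite mul0rn add0r. Qed.
Fact fps_addN : left_inverse (fps_const 0) fps_opp fps_add.
Proof. by move=> f; apply: fpsP => n /=; rewrite mul0rn addNr. Qed.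

HB.instance Definition _ :=
  GRing.isZmodule.Build (fps K) fps_addA fps_addC fps_add0 fps_addN.

Fact fps_mulC : commutative fps_mul.
Proof.
move=> f g; apply: fpsP => n /=.
rewrite (reindex_inj rev_ord_inj) /=; apply: eq_bigr => i _.
by rewrite mulrC subSS subKn // -ltnS.
Qed.

Fact fps_mulA : associative fps_mul.
Proof.
move=> f g h; apply: fpsP => n /=.
pose F j k := fcoef f j * (fcoef g (n - j - k)%N * fcoef h k).
transitivity (\sum_(j < n.+1) \sum_(k < n.+1 | (k <= n - j)%N) F j k).
  apply: eq_bigr => /= j _; rewrite big_distrr /=.
  rewrite (big_ord_narrow_leq (leq_subr _ _)).
  rewrite (reindex_inj rev_ord_inj) /=; apply: eq_bigr => k _.
  by rewrite /F subSS subKn // -ltnS.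
rewrite (exchange_big_dep predT) //= [RHS](reindex_inj rev_ord_inj) /=.
apply: eq_bigr => k _; rewrite subSS.
transitivity (\sum_(j < n.+1 | (j <= n - k)%N) F j k).
  apply: eq_bigl => j; rewrite -ltnS -(ltnS j) -!subSn ?leq_ord //.
  by rewrite -subn_gt0 -(subn_gt0 j) -!subnDA addnC.
rewrite (big_ord_narrow_leq (leq_subr _ _)) subKn ?leq_ord // mulr_suml.
by apply: eq_bigr => j _; rewrite /F mulrA -!subnDA (addnC k).
Qed.

Fact fps_mul1 : left_id (fps_const 1) fps_mul.
Proof.
move=> f; apply: fpsP => n /=.
by rewrite big_ord_recl /= mul1r subn0 big1 ?addr0 // => i _; rewrite mul0r.
Qed.

Fact fps_mulDl : left_distributive fps_mul fps_add.
Proof.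
move=> f g h; apply: fpsP => n /=; rewrite -big_split /=.
by apply: eq_bigr => i _; rewrite mulrDl.
Qed.

Fact fps_1neq0 : fps_const 1 != 0.
Proof.
by apply/eqP => /(congr1 (fun f => fcoef f 0)) /= /eqP; rewrite oner_eq0.
Qed.

HB.instance Definition _ := GRing.Zmodule_isComNzRing.Build (fps K)
  fps_mulA fps_mulC fps_mul1 fps_mulDl fps_1neq0.

Fact fps_const_is_zmod_morphism : zmod_morphism fps_const.
Proof. by move=> a b; apply: fpsP => n /=; rewrite mulrnBl. Qed.

Fact fps_const_is_monoid_morphism : monoid_morphism fps_const.
Proof.
split=> // a b; apply: fpsP => n /=; rewrite big_ord_recl /= subn0 mulrnAr.
by rewrite big1 ?addr0 // => i _; rewrite mul0r.
Qed.

HB.instance Definition _ :=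
  GRing.isZmodMorphism.Build K (fps K) fps_const fps_const_is_zmod_morphism.
HB.instance Definition _ :=
  GRing.isMonoidMorphism.Build K (fps K) fps_const fps_const_is_monoid_morphism.

Definition fpsX : fps K := mkFps (fun n => (n == 1)%N%:R).

End Ring.

Section UnitRing.
Variable K : comUnitRingType.
Implicit Types f g : fps K.

Definition fps_unit : pred (fps K) := fun f => fcoef f 0 \is a GRing.unit.

(* The first n coefficients of f^-1, from the recurrence
   f_0 g_k = - \sum_(i < k) f_(k - i) g_i obtained from f * g = 1. *)
Fixpoint fps_inv_seq f (n : nat) : seq K :=
  if n is k.+1 then
    let s := fps_inv_seq f k in
    rcons s ((fcoef f 0)^-1 *
             ((k == 0)%N%:R - \sum_(i < k) fcoef f (k - i)%N * s`_i))
  else [::].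

(* Following the convention of unitRingType, a non-unit is its own inverse. *)
Definition fps_inv f : fps K :=
  if fps_unit f then mkFps (fun n => (fps_inv_seq f n.+1)`_n) else f.

Lemma size_fps_inv_seq f n : size (fps_inv_seq f n) = n.
Proof. by elim: n => //= n IHn; rewrite size_rcons IHn. Qed.

Lemma nth_fps_inv_seq f n i :
  (i < n)%N -> (fps_inv_seq f n)`_i = (fps_inv_seq f i.+1)`_i.
Proof.
elim: n => // n IHn; rewrite ltnS leq_eqVlt => /predU1P[-> //|lt_in].
by rewrite [LHS]/= nth_rcons size_fps_inv_seq lt_in IHn.
Qed.

Lemma fps_inv_seqE f n : (fps_inv_seq f n.+1)`_n = (fcoef f 0)^-1 *
  ((n == 0)%N%:R - \sum_(i < n) fcoef f (n - i)%N * (fps_inv_seq f i.+1)`_i).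
Proof.
rewrite [LHS]/= nth_rcons size_fps_inv_seq ltnn eqxx.
by under eq_bigr => i _ do rewrite nth_fps_inv_seq //.
Qed.

Fact fps_mulV : {in fps_unit, left_inverse 1 fps_inv *%R}.
Proof.
move=> f; rewrite unfold_in => Uf; rewrite mulrC /fps_inv /fps_unit Uf; apply: fpsP => n.
transitivity (\sum_(i < n.+1) fcoef f (n - i)%N * (fps_inv_seq f i.+1)`_i).
  rewrite [LHS]/= (reindex_inj rev_ord_inj) /=; apply: eq_bigr => i _.
  by rewrite !subSS subKn // -ltnS.
have -> : fcoef (1 : fps K) n = (n == 0)%N%:R by [].
rewrite big_ord_recr fps_inv_seqE subnn mulrA.
by rewrite divrr // mul1r; apply: subrKC.
Qed.

Fact fps_unitP f g : g * f = 1 -> fps_unit f.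
Proof.
move=> /(congr1 (fun h => fcoef h 0)) /=.
rewrite big_ord_recl big_ord0 addr0 subnn => gf1.
by apply/unitrPr; exists (fcoef g 0); rewrite mulrC.
Qed.

Fact fps_inv_out : {in [predC fps_unit], fps_inv =1 id}.
Proof.
by move=> f; rewrite inE unfold_in /fps_inv /fps_unit => /negbTE ->.
Qed.

HB.instance Definition _ := GRing.ComNzRing_hasMulInverse.Build (fps K)
  fps_mulV fps_unitP fps_inv_out.

End UnitRing.

(* Words with letters in [n]; the element i : 'I_n stands for the letter i+1. *)
Definition letters (n : nat) (w : n.-tuple 'I_n) : seq nat :=
  [seq (val i).+1 | i <- w].

Definition parking (w : seq nat) : bool :=
  [forall i : 'I_(size w), nth 0%N (sort leq w) i <= i.+1]%N.

Definition tie (w : seq nat) : nat :=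
  count (fun i => nth 0 w i == nth 0 w i.+1)%N (iota 0 (size w).-1).

(* Positions are counted from 0, so an interior position is some i with
   1 <= i < size w - 1. *)
Definition pk (w : seq nat) : nat :=
  count (fun i => (nth 0 w i.-1 < nth 0 w i) && (nth 0 w i.+1 < nth 0 w i))%N
        (iota 1 (size w - 2)).

Section Insertion.
Variable R : realType.

Local Notation P := {mpoly R[2]}.

Definition tvar : P := 'X_0.
Definition uvar : P := 'X_1.

Definition Hpoly (n m : nat) : P :=
  \sum_(w : n.-tuple 'I_n |
        parking (letters w) && (\max_(a <- letters w) a <= m)%N)
     tvar ^+ pk (letters w) * uvar ^+ tie (letters w).

Local Notation z := (fpsX P).
Local Notation "c %:S" := (fps_const (c : P)) (at level 2, format "c %:S").

Definition serE : fps P := 1 + z / (1 - uvar%:S * z).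
Definition serA : fps P :=
  1 + tvar%:S * z + uvar%:S * z ^+ 2 / (1 - uvar%:S * z).
Definition serC : fps P :=
  uvar%:S + tvar%:S * z + uvar%:S * z ^+ 2 / (1 - uvar%:S * z).
Definition serB : fps P := serA ^+ 2 + tvar%:S - 1.

(* F(x, y) : substitution of x for t and y for u in F. *)
Definition fps_subst (F : P) (x y : fps P) : fps P :=
  mmap (fun c : R => (c%:MP)%:S) (fun i : 'I_2 => if i == 0 then x else y) F.

Definition insertion (l r : nat) (F : P) : P :=
  fcoef (serE ^+ 2 * serA ^+ l.-1
         * fps_subst F (serB / serA ^+ 2) (serC / serA)) r.

End Insertion.

(* Main.v *)
(* Remove from a word with maximum m all its r copies of m: a word v of length
   l = n - r remains, and w is parking iff v is and m <= l + 1. Conversely, the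
   copies of m go into the l + 1 gaps of v. Each of the two outer gaps
   contributes E; an inner gap contributes A if its neighbours differ and are
   not peaks, and C if they are tied; the two gaps around a peak contribute B
   together, since the peak survives only if both stay empty. These gaps are
   disjoint, so v contributes E^2 A^(l-1) (B/A^2)^pk(v) (C/A)^tie(v). *)
Require Import Defs.
From HB Require Import structures.
From mathcomp Require Import all_boot all_order all_algebra.
From mathcomp Require Import boolp reals.
From mathcomp Require Import mpoly.
From mathcomp Require Import zify ring.

Set Implicit Arguments.
Unset Strict Implicit.
Unset Printing Implicit Defensive.

Import GRing.Theory.
Local Open Scope ring_scope.

(** * Coefficients of power series *)

Lemma fcoef_sum (K : comNzRingType) (I : Type) (s : seq I) (Q : pred I)
    (F : I -> fps K) (n : nat) :
  fcoef (\sum_(i <- s | Q i) F i) n = \sum_(i <- s | Q i) fcoef (F i) n.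
Proof.
elim: s => [|i s IHs]; first by rewrite !big_nil /= mul0rn.
by rewrite !big_cons; case: (Q i) => //=; rewrite IHs.
Qed.

Lemma fcoefD (K : comNzRingType) (f g : fps K) (n : nat) :
  fcoef (f + g) n = fcoef f n + fcoef g n.
Proof. by []. Qed.

Lemma fcoef0M (K : comNzRingType) (f g : fps K) :
  fcoef (f * g) 0 = fcoef f 0 * fcoef g 0.
Proof. by rewrite /= big_ord_recl big_ord0 addr0. Qed.

Lemma fcoef_constM (K : comNzRingType) (c : K) (f : fps K) (n : nat) :
  fcoef (fps_const c * f) n = c * fcoef f n.
Proof.
by rewrite /= big_ord_recl /= subn0 big1 ?addr0 // => i _; rewrite mul0r.
Qed.

Lemma fcoef_XM (K : comNzRingType) (f : fps K) (n : nat) :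
  fcoef (fpsX K * f) n = if n is k.+1 then fcoef f k else 0.
Proof.
case: n => [|n] /=; rewrite big_ord_recl /= mul0r add0r ?big_ord0 //.
rewrite big_ord_recl /= mul1r subSS subn0 big1 ?addr0 // => i _.
by rewrite mul0r.
Qed.

Lemma fps_unitE (K : comUnitRingType) (f : fps K) :
  (f \is a GRing.unit) = (fcoef f 0 \is a GRing.unit).
Proof. by []. Qed.

Lemma rmorph_sum_monomials (K L : comNzRingType) (phi : {rmorphism K -> L})
    (x y : K) (a b : L) (xa : phi x = a) (yb : phi y = b)
    (I : Type) (s : seq I) (Q : pred I) (p q : I -> nat) :
  phi (\sum_(i <- s | Q i) x ^+ p i * y ^+ q i)
  = \sum_(i <- s | Q i) a ^+ p i * b ^+ q i.
Proof.
rewrite rmorph_sum; apply: eq_bigr => i _.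
by rewrite rmorphM !rmorphXn xa yb.
Qed.

(** * Ties, peaks, insertions and words on lists *)

Lemma tie_cons2 (x a : nat) (s : seq nat) :
  tie [:: x, a & s] = ((x == a) + tie (a :: s))%N.
Proof. by rewrite /tie /= (iotaDl 1 0) count_map. Qed.

Lemma pk_cons3 (y x a : nat) (s : seq nat) :
  pk [:: y, x, a & s] = ((y < x) && (a < x) + pk [:: x, a & s])%N.
Proof.
rewrite /pk /= !subSS !subn0 /= (iotaDl 1 1) count_map; congr (_ + _)%N.
by apply: eq_in_count => -[|j]; rewrite mem_iota.
Qed.

Lemma pk_no_ascent (y x : nat) (s : seq nat) :
  (y < x)%N = false -> pk [:: y, x & s] = pk (x :: s).
Proof. by case: s => [|a s] // yx; rewrite pk_cons3 yx. Qed.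

Section Weight.
Variable K : comNzRingType.
Implicit Types t u : K.

(* The weight of a word [s] that continues a word ending in the letter [x];
   [up] tells whether that [x] was entered by an ascent. *)
Fixpoint wt_after t u (up : bool) (x : nat) (s : seq nat) : K :=
  if s is a :: s' then
    u ^+ (x == a) * t ^+ (up && (a < x)%N) * wt_after t u (x < a)%N a s'
  else 1.

(** [K], [t] and [u] stay arbitrary because the weight is used twice: with the polynomial variables,
    and with the series B/A^2 and C/A. *)
Definition wt t u (w : seq nat) : K :=
  if w is x :: s then wt_after t u false x s else 1.

(** The letter [y] matters only through [y < x], so one bit of memory suffices to compute the weight
    from left to right. *)
Lemma wt_afterE t u (y x : nat) (s : seq nat) :
  wt_after t u (y < x)%N x s = t ^+ pk [:: y, x & s] * u ^+ tie (x :: s).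
Proof.
elim: s x y => [|a s IHs] x y /=; first by rewrite !expr0 mulr1.
by rewrite IHs pk_cons3 tie_cons2 !exprD; ring.
Qed.

Lemma wtE t u (w : seq nat) : wt t u w = t ^+ pk w * u ^+ tie w.
Proof.
case: w => [|x s] /=; first by rewrite !expr0 mulr1.
by rewrite -(ltnn x) wt_afterE pk_no_ascent // ltnn.
Qed.

End Weight.

(* [M] is meant not to occur in [v]; each word is then listed only once. *)
Fixpoint insertions (M : nat) (v : seq nat) : nat -> seq (seq nat) :=
  if v is x :: v' then
    fix go r := [seq x :: w | w <- insertions M v' r]
                ++ (if r is r'.+1 then [seq M :: w | w <- go r'] else [::])
  else fun r => [:: nseq r M].

Lemma insertions_cons (M x : nat) (v : seq nat) (r : nat) :
  insertions M (x :: v) r = [seq x :: w | w <- insertions M v r]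
    ++ (if r is r'.+1 then [seq M :: w | w <- insertions M (x :: v) r']
        else [::]).
Proof. by case: r. Qed.

Lemma insertions0 (M : nat) (v : seq nat) : insertions M v 0 = [:: v].
Proof. by elim: v => //= x v ->. Qed.

Lemma perm_insertions (M : nat) (v : seq nat) (r : nat) (w : seq nat) :
  w \in insertions M v r -> perm_eq w (v ++ nseq r M).
Proof.
elim: v r w => [|x v IHv] r w; first by rewrite /= inE => /eqP ->.
elim: r w => [|r IHr] w; rewrite insertions_cons mem_cat.
  by rewrite orbF => /mapP[w' /IHv pw ->]; rewrite /= perm_cons.
case/orP=> /mapP[w' ww ->]; first by rewrite cat_cons perm_cons IHv.
have -> : (x :: v) ++ nseq r.+1 M = (x :: v) ++ ([:: M] ++ nseq r M) by [].
by rewrite perm_sym perm_catCA /= perm_cons perm_sym; apply: IHr.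
Qed.

(** Unlike tuples over ['I_n], these lists let length and alphabet vary independently, as the
    removal of the maximum requires. *)
Fixpoint words (k m : nat) : seq (seq nat) :=
  if k is k'.+1 then [seq a :: w | a <- iota 1 m, w <- words k' m]
  else [:: [::]].

Lemma mem_words (k m : nat) (w : seq nat) :
  (w \in words k m) = (size w == k) && all (fun a => 0 < a <= m)%N w.
Proof.
elim: k w => [|k IHk] [|a w] //=.
  by apply/allpairsP => -[[b v] /= [_ _]].
rewrite eqSS; apply/allpairsP/and3P => [[[b v] /= [bm vw [-> ->]]]|[sw am wm]].
  by move: vw bm; rewrite IHk mem_iota add1n ltnS => /andP[-> ->] ->.
by exists (a, w) => /=; rewrite mem_iota add1n ltnS am IHk sw wm.
Qed.

Lemma words_uniq (k m : nat) : uniq (words k m).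
Proof.
elim: k => //= k IHk; apply: allpairs_uniq; rewrite ?iota_uniq //.
by move=> [a v] [b w] _ _ [-> ->].
Qed.

Lemma words_one (k : nat) : words k 1 = [:: nseq k 1%N].
Proof. by elim: k => //= k ->. Qed.

(** * Sums over words, sorted by the number of copies of the maximum *)

Section WordSums.
Variable V : nmodType.
Implicit Type f : seq nat -> V.

Lemma sum_letters (n m : nat) (Q : pred (seq nat)) f :
    (0 < n)%N -> (m <= n)%N ->
  \sum_(w : n.-tuple 'I_n |
        Q (letters w) && (\max_(a <- letters w) a <= m)%N)
    f (letters w) = \sum_(w <- words n m | Q w) f w.
Proof.
move=> n0 mn.
have lettersP (w : n.-tuple 'I_n) :
    (\max_(a <- letters w) a <= m)%N = all (fun a => a <= m)%N (letters w).
  apply/bigmax_leqP_seq/allP => H a aw; first exact: H.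
  by move=> _; apply: H.
have letters_inj : injective (@letters n).
  by move=> v w /(inj_map (inj_comp succn_inj val_inj)) /val_inj.
pose ws := [seq letters w | w in
  [pred w : n.-tuple 'I_n | all (fun a => a <= m)%N (letters w)]].
have ws_words : perm_eq ws (words n m).
  apply: uniq_perm; rewrite ?words_uniq //.
    by rewrite map_inj_uniq ?enum_uniq.
  move=> s; rewrite mem_words; apply/imageP/andP => [[w wm ->]|[/eqP sz sm]].
    rewrite size_map size_tuple eqxx; split=> //.
    apply/allP => a aw; rewrite (allP wm a aw) andbT.
    by case/mapP: aw => i _ ->.
  case: n n0 mn letters_inj sz {lettersP ws} => // n' _ mn _ sz.
  have sz' : size [seq inord a.-1 : 'I_n'.+1 | a <- s] == n'.+1.
    by rewrite size_map sz.
  have sE : s = letters (Tuple sz').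
    rewrite /letters /= -map_comp -[LHS]map_id; apply/eq_in_map => a /(allP sm).
    case/andP=> a0 am /=; rewrite inordK ?prednK //.
    exact: leq_trans am mn.
  exists (Tuple sz') => //; rewrite inE -sE.
  by apply: sub_all sm => a /andP[].
rewrite -(perm_big _ ws_words) /= big_map big_enum_cond /=.
by apply: eq_bigl => w; rewrite andbC lettersP inE.
Qed.

Let split_sum (m l r : nat) f : V :=
  \sum_(v <- words l m) \sum_(w <- insertions m.+1 v r) f w.

Let split_sum_rec (m l r : nat) f : (0 < l + r)%N ->
  split_sum m l r f =
    (if l is l'.+1 then
       \sum_(a <- iota 1 m) split_sum m l' r (fun w => f (a :: w)) else 0)
    + (if r is r'.+1 then split_sum m l r' (fun w => f (m.+1 :: w)) else 0).
Proof.
rewrite /split_sum; case: l => [|l] /= lr.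
  by case: r lr => // r _; rewrite add0r !big_seq1.
rewrite big_allpairs_dep /=; case: r lr => [|r] _.
  rewrite addr0; apply: eq_bigr => a _; apply: eq_bigr => v _.
  by rewrite cats0 big_map.
rewrite [in X in _ = _ + X]big_allpairs_dep /= -big_split /=.
apply: eq_bigr => a _; rewrite -big_split /=; apply: eq_bigr => v _.
by rewrite big_cat !big_map.
Qed.

(** Induction on [k] by first letter: a letter at most [m] shortens [v] and keeps [r], while the
    letter [m.+1] lowers [r]. *)
Lemma sum_words_top (k m : nat) f :
  \sum_(w <- words k m.+1) f w =
  \sum_(r < k.+1) \sum_(v <- words (k - r) m)
     \sum_(w <- insertions m.+1 v r) f w.
Proof.
elim: k f => [|k IHk] f; first by rewrite big_ord1 /= !big_seq1.
have -> : \sum_(w <- words k.+1 m.+1) f w =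
    \sum_(a <- iota 1 m) \sum_(w <- words k m.+1) f (a :: w)
    + \sum_(w <- words k m.+1) f (m.+1 :: w).
  transitivity (\sum_(a <- iota 1 m.+1) \sum_(w <- words k m.+1) f (a :: w)).
    exact: big_allpairs_dep.
  by rewrite -[X in iota 1 X]addn1 iotaD big_cat big_seq1 add1n.
transitivity (\sum_(r < k.+2)
   ((if (k.+1 - r)%N is l.+1 then
       \sum_(a <- iota 1 m) split_sum m l r (fun w => f (a :: w)) else 0)
    + (if r : nat is r'.+1 then
         split_sum m (k.+1 - r) r' (fun w => f (m.+1 :: w)) else 0)));
  last first.
  apply: eq_bigr => r _; rewrite -split_sum_rec // subnK //.
  by rewrite -ltnS.
(* At [r = k.+1] no old letter is left and at [r = 0] no new one, so these end terms vanish; the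
   rest matches the induction hypothesis. *)
rewrite big_split /= [X in _ = X + _]big_ord_recr [X in _ = _ + X]big_ord_recl /=.
rewrite subnn addr0 add0r.
congr (_ + _); last by rewrite IHk.
under eq_bigr => a _ do rewrite IHk.
rewrite exchange_big /=; apply: eq_bigr => r _.
by rewrite subSn // -ltnS.
Qed.

End WordSums.

(** * The parking condition under insertion *)

Lemma parkingE (w : seq nat) : parking w =
  all (fun i => nth 0 (sort leq w) i <= i.+1)%N (iota 0 (size w)).
Proof.
apply/forallP/allP => [pw i|pw i]; last by apply: pw; rewrite mem_iota /=.
by rewrite mem_iota => iw; apply: (pw (Ordinal iw)).
Qed.

Lemma perm_parking (v w : seq nat) : perm_eq v w -> parking v = parking w.
Proof.
move=> vw; rewrite !parkingE (perm_size vw).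
by have /(perm_sortP leq_total leq_trans anti_leq) -> := vw.
Qed.

(** After sorting, the copies of [M] come last; the tightest bound is that of the first copy, at
    position [(size v).+1]. *)
Lemma parking_cat_nseq (M r : nat) (v : seq nat) :
    (0 < r)%N -> all (fun a => a < M)%N v ->
  parking (v ++ nseq r M) = parking v && (M <= (size v).+1)%N.
Proof.
move=> r0 vM.
have sortE : sort leq (v ++ nseq r M) = sort leq v ++ nseq r M.
  apply: (sorted_eq leq_trans anti_leq); first exact: sort_sorted leq_total _.
    rewrite (sorted_pairwise leq_trans) pairwise_cat.
    rewrite -!(sorted_pairwise leq_trans).
    rewrite sort_sorted /=; last exact: leq_total.
    apply/andP; split; last first.
      by case: r {r0} => //; elim=> //= r ->; rewrite leqnn.
    apply/allrelP => a b; rewrite mem_sort mem_nseq => /(allP vM) aM.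
    by case/andP=> _ /eqP ->; apply: ltnW.
  by rewrite perm_sort perm_cat2r perm_sym perm_sort.
rewrite !parkingE sortE size_cat size_nseq iotaD all_cat; congr (_ && _).
  apply: eq_in_all => i; rewrite mem_iota /= add0n => iv.
  by rewrite nth_cat size_sort iv.
apply/allP/idP => [/(_ (size v))|Mv i].
  by rewrite mem_iota nth_cat size_sort ltnn subnn nth_nseq r0; apply; lia.
rewrite mem_iota nth_cat size_sort nth_nseq => /andP[vi ir].
by case: ifP => [|_]; [lia|case: ifP => //; lia].
Qed.

(** Parking depends only on the multiset of letters, hence is constant on all insertions into
    [v]. *)
Lemma sum_parking_insertions (V : nmodType) (M r : nat) (v : seq nat)
    (f : seq nat -> V) : (0 < r)%N -> all (fun a => a < M)%N v ->
  \sum_(w <- insertions M v r | parking w) f w =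
  if parking v && (M <= (size v).+1)%N then \sum_(w <- insertions M v r) f w
  else 0.
Proof.
move=> r0 vM; rewrite big_mkcond -(parking_cat_nseq r0 vM).
have pE w : w \in insertions M v r -> parking w = parking (v ++ nseq r M).
  by move/perm_insertions/perm_parking.
rewrite big_seq; under eq_bigr => w /pE -> do [].
by rewrite -big_seq; case: ifP => // _; rewrite big1.
Qed.

(** * Generating series of insertions *)

Section InsertionSeries.
Variables (K : comNzRingType) (M : nat).
Implicit Type f : seq nat -> K.

Definition ins_series f (v : seq nat) : fps K :=
  mkFps (fun r => \sum_(w <- insertions M v r) f w).

Lemma ins_seriesZ (c : K) f v :
  ins_series (fun w => c * f w) v = fps_const c * ins_series f v.
Proof. by apply: fpsP => r; rewrite fcoef_constM /= mulr_sumr. Qed.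

Lemma ins_series_nil (f g : seq nat -> K) (c : K) :
    (forall w, f (M :: w) = c * g w) ->
  ins_series f [::] =
  fps_const (f [::]) + fpsX K * (fps_const c * ins_series g [::]).
Proof.
move=> fg; rewrite -ins_seriesZ; apply: fpsP => r; rewrite fcoefD fcoef_XM /=.
by case: r => [|r]; rewrite /= !big_seq1 ?fg ?addr0 ?add0r.
Qed.

(** An inserted word starts with [x], or with a copy of [M] that costs one factor [z] and leaves
    [x :: v] intact. *)
Lemma ins_series_cons (f g h : seq nat -> K) (a c : K) (x : nat) (v : seq nat) :
    (forall w, f (x :: w) = a * g w) -> (forall w, f (M :: w) = c * h w) ->
  ins_series f (x :: v) = fps_const a * ins_series g v
    + fpsX K * (fps_const c * ins_series h (x :: v)).
Proof.
move=> fg fh; rewrite -!ins_seriesZ; apply: fpsP => r.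
rewrite fcoefD fcoef_XM [LHS]/= -/(insertions M (x :: v)) insertions_cons.
rewrite big_cat big_map (eq_bigr (fun w => a * g w)) => [|w _]; last exact: fg.
congr (_ + _); case: r => [|r]; rewrite ?big_nil ?big_map //.
by apply: eq_bigr => w _; apply: fh.
Qed.

End InsertionSeries.

(** * Evaluation of the gaps *)

Section GapSeries.
Variable R : realType.
Local Notation P := {mpoly R[2]}.
Local Notation z := (fpsX P).
Local Notation t := (tvar R).
Local Notation u := (uvar R).
Local Notation E := (serE R).
Local Notation A := (serA R).
Local Notation B := (serB R).
Local Notation C := (serC R).
Local Notation "c %:S" := (fps_const (c : P)) (at level 2, format "c %:S").

Lemma unit_1Buz : (1 - u%:S * z) \is a GRing.unit.
Proof.
rewrite fps_unitE fcoefD /= big_ord_recl big_ord0 /= mulr0 !addr0 subr0.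
exact: unitr1.
Qed.

Lemma unit_serA : A \is a GRing.unit.
Proof.
by rewrite fps_unitE !fcoefD expr2 !fcoef0M /= !(mulr0, mul0r, addr0) unitr1.
Qed.

(** This sums over runs of the maximum: each further copy is a tie, worth [u * z]. *)
Lemma geometric_fixpoint (X Y : fps P) :
  X = Y + z * (u%:S * X) -> X = Y / (1 - u%:S * z).
Proof.
move=> XE; apply: (mulIr unit_1Buz); rewrite divrK ?unit_1Buz //.
by apply: (addIr (z * (u%:S * X))); rewrite -XE; ring.
Qed.

Lemma serE_geometric : E = 1 + z / (1 - u%:S * z).
Proof. by []. Qed.

(** This is a nonempty gap between smaller letters: one copy is a peak, giving t z; j >= 2 copies
    form a plateau with j - 1 ties and no strict peak. *)
Lemma serA_geometric :
  A - 1 = z * (t%:S + z * u%:S / (1 - u%:S * z)).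
Proof. by rewrite /serA; ring. Qed.

Section NewMaximum.
Variable M : nat.

Local Notation J up x v := (ins_series M (wt_after t u up x) v).

Lemma wt_after_top (up : bool) (w : seq nat) :
  wt_after t u up M (M :: w) = u * wt_after t u false M w.
Proof. by rewrite /= eqxx ltnn andbF mulr1. Qed.

Lemma wt_after_to_top (up : bool) (x : nat) (w : seq nat) : (x < M)%N ->
  wt_after t u up x (M :: w) = 1 * wt_after t u true M w.
Proof.
by move=> xM; rewrite /= (ltn_eqF xM) xM ltnNge ltnW // andbF !mul1r.
Qed.

Lemma wt_after_from_top (up : bool) (x : nat) (w : seq nat) : (x < M)%N ->
  wt_after t u up M (x :: w) = t ^+ up * wt_after t u false x w.
Proof.
by move=> xM; rewrite /= (gtn_eqF xM) xM andbT mul1r ltnNge ltnW.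
Qed.

Lemma ins_after_top_nil (up : bool) : J up M [::] = (1 - u%:S * z)^-1.
Proof.
(* A tie resets the state to [false], so the recurrence is solved there and then applied once for
   [up]. *)
have rec b : J b M [::] = 1 + z * (u%:S * J false M [::]).
  exact: ins_series_nil (wt_after_top b).
rewrite rec (geometric_fixpoint (rec false)) div1r.
apply: (mulIr unit_1Buz); rewrite mulrDl mulVr ?unit_1Buz //.
by rewrite -!mulrA mulVr ?unit_1Buz //; ring.
Qed.

(** Either [x] follows at once, and [M] is a peak if [up], or a run of ties follows, which rules out
    a peak. *)
Lemma ins_after_top_cons (up : bool) (x : nat) (v : seq nat) : (x < M)%N ->
  J up M (x :: v)
  = ((t ^+ up)%:S + z * u%:S / (1 - u%:S * z)) * J false x v.
Proof.
move=> xM.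
have rec b : J b M (x :: v) =
    (t ^+ b)%:S * J false x v + z * (u%:S * J false M (x :: v)).
  apply: ins_series_cons => w; first exact: wt_after_from_top.
  exact: wt_after_top.
have := geometric_fixpoint (rec false); rewrite mul1r => J0.
by rewrite rec J0; ring.
Qed.

Lemma ins_after_nil (up : bool) (x : nat) : (x < M)%N -> J up x [::] = E.
Proof.
move=> xM; rewrite serE_geometric -(ins_after_top_nil true).
have -> : J up x [::] = 1 + z * (1 * J true M [::]).
  by apply: ins_series_nil => w; apply: wt_after_to_top.
by rewrite mul1r.
Qed.

(** The summands are the empty and the nonempty gap between [x] and [a]; from a nonempty gap [a] is
    entered by a descent. *)
Lemma ins_after_cons (up : bool) (x a : nat) (v : seq nat) :
    (x < M)%N -> (a < M)%N ->
  J up x (a :: v) =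
  (u ^+ (x == a) * t ^+ (up && (a < x)%N))%:S * J (x < a)%N a v
  + (A - 1) * J false a v.
Proof.
move=> xM aM.
have -> : J up x (a :: v) =
    (u ^+ (x == a) * t ^+ (up && (a < x)%N))%:S * J (x < a)%N a v
    + z * (1 * J true M (a :: v)).
  apply: ins_series_cons => w; last exact: wt_after_to_top.
  exact: erefl.
by rewrite serA_geometric (ins_after_top_cons true v aM) mul1r mulrA.
Qed.

(* The second identity adds the gap before [x] when [x] is entered by an ascent:
   it is empty ([J true]) or not ([A - 1] times [J false]). The two gaps around
   a peak [x] can only be evaluated together. *)
Lemma ins_after_closed_form (b c : fps P) (x : nat) (v : seq nat) :
    b * A ^+ 2 = B -> c * A = C -> (x < M)%N -> all (fun a => a < M)%N v ->
  J false x v = E * A ^+ size v * wt_after b c false x v /\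
  J true x v + (A - 1) * J false x v
  = E * A ^+ (size v).+1 * wt_after b c true x v.
Proof.
move=> bE cE; elim: v x => [|a v IHv] x xM /=.
  move=> _; rewrite (ins_after_nil false xM) (ins_after_nil true xM).
  by split; ring.
case/andP=> aM /(IHv a aM){IHv} [].
have BE : B = A ^+ 2 + t%:S - 1 by [].
have CE : C = u%:S + (A - 1) by rewrite /serC /serA; ring.
rewrite !ins_after_cons // !exprS.
(* If [a < x], the two gaps around a peak [x] give t + 2(A - 1) + (A - 1)^2 = B. If [x < a], the
   second induction hypothesis absorbs the gap. A tie gives u + (A - 1) = C. *)
case: ltngtP => /= [ax|xa|xa] J0 J1; rewrite ?expr0 ?expr1 ?mulr1 ?mul1r.
- rewrite J0; split; first by ring.
  transitivity (E * A ^+ size v * wt_after b c false a v * B).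
    by rewrite BE; ring.
  by rewrite -bE; ring.
- by rewrite J1; split; ring.
- have stepE : u%:S * J false a v + (A - 1) * J false a v
      = E * (A * A ^+ size v) * (c * wt_after b c false a v).
    transitivity (C * J false a v); first by rewrite CE; ring.
    by rewrite J0 -cE; ring.
  by rewrite stepE; split => //; ring.
Qed.

(** The copies before the first letter supply the second factor [E]. *)
Lemma ins_series_closed_form (b c : fps P) (w : seq nat) :
    b * A ^+ 2 = B -> c * A = C -> w != [::] -> all (fun a => a < M)%N w ->
  ins_series M (wt t u) w = E ^+ 2 * A ^+ (size w).-1 * wt b c w.
Proof.
move=> bE cE; case: w => [//|x v] _ /= /andP[xM vM].
have [J0 _] := ins_after_closed_form bE cE xM vM.
have -> : ins_series M (wt t u) (x :: v) =
    1 * J false x v + z * (1 * J false M (x :: v)).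
  by apply: ins_series_cons => w; rewrite /= mul1r.
have geomE : (1 : P)%:S + z * u%:S / (1 - u%:S * z) = (1 - u%:S * z)^-1.
  apply: (mulIr unit_1Buz); rewrite mulrDl divrK ?unit_1Buz //.
  by rewrite mulVr ?unit_1Buz // rmorph1; ring.
rewrite (ins_after_top_cons false v xM) expr0 geomE J0.
transitivity ((1 + z / (1 - u%:S * z))
              * (E * A ^+ size v * wt_after b c false x v)).
  by ring.
by rewrite -serE_geometric; ring.
Qed.

End NewMaximum.

Lemma fps_subst_sum_monomials (b c : fps P) (I : Type) (ws : seq I)
    (Q : pred I) (p q : I -> nat) :
  fps_subst (\sum_(w <- ws | Q w) t ^+ p w * u ^+ q w) b c
  = \sum_(w <- ws | Q w) b ^+ p w * c ^+ q w.
Proof.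
pose h : {rmorphism R -> fps P} := (@fps_const P) \o (@mpolyC 2 R).
pose g (i : 'I_2) := if i == 0 then b else c.
have substX i : mmap h g 'X_i = g i by rewrite mmapX mmap1U.
exact: (@rmorph_sum_monomials _ _ (mmap h g) _ _ _ _ (substX 0) (substX 1)).
Qed.

End GapSeries.

(** * The recurrence for parking functions *)

Lemma HpolyE (R : realType) (n m : nat) : (0 < n)%N -> (m <= n)%N ->
  Hpoly R n m = \sum_(w <- words n m | parking w) wt (tvar R) (uvar R) w.
Proof.
move=> n0 mn; rewrite -(sum_letters _ _ n0 mn); apply: eq_bigr => w _.
by rewrite wtE.
Qed.

(** Substitution into the weight of [v] gives [wt b c v] with b = B/A^2 and c = C/A, so the closed
    form applies to each [v] separately. *)
Lemma insertion_Hpoly (R : realType) (l r k : nat) : (0 < l)%N -> (k <= l)%N ->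
  insertion l r (Hpoly R l k) =
  \sum_(v <- words l k | parking v)
     \sum_(w <- insertions k.+1 v r) wt (tvar R) (uvar R) w.
Proof.
move=> l0 kl; rewrite (HpolyE R l0 kl).
under eq_bigr => v _ do rewrite wtE.
rewrite /insertion fps_subst_sum_monomials mulr_sumr fcoef_sum.
rewrite big_seq_cond [RHS]big_seq_cond; apply: eq_bigr => v /andP[].
rewrite mem_words => /andP[/eqP sv vk] _.
pose S := ins_series k.+1 (wt (tvar R) (uvar R)) v.
rewrite -wtE -[RHS]/(fcoef S r); congr fcoef.
rewrite /S (@ins_series_closed_form R k.+1 (serB R / serA R ^+ 2)
             (serC R / serA R)) ?sv //.
- by rewrite divrK ?unitrX ?unit_serA.
- by rewrite divrK ?unit_serA.
- by rewrite -size_eq0 sv -lt0n.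
- by apply: sub_all vk => a /andP[_]; rewrite ltnS.
Qed.

Lemma Hpoly1 (R : realType) (n : nat) : (0 < n)%N ->
  Hpoly R n 1 = uvar R ^+ n.-1.
Proof.
move=> n0; rewrite HpolyE // words_one big_mkcond big_seq1.
have -> : parking (nseq n 1%N).
  (* The constant word is the empty word followed by [n] copies of 1. *)
  by rewrite (parking_cat_nseq (v := [::]) (M := 1)) // parkingE.
case: n n0 => // n _ /=; elim: n => //= n ->.
by rewrite expr0 expr1 mulr1 exprS.
Qed.

Theorem theorem1p2 (R : realType) (n : nat) :
  ((1 <= n)%N -> Hpoly R n 1 = uvar R ^+ (n - 1)) /\
  (forall m : nat, (2 <= m <= n)%N ->
     Hpoly R n m = Hpoly R n (m - 1)
       + \sum_(1 <= r < (n - m + 1).+1) insertion (n - r) r (Hpoly R (n - r) (m - 1))).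
Proof.
rewrite !subn1; split=> [n1|[//|k] /andP[k1 kn]]; first exact: Hpoly1.
rewrite subn1 /= HpolyE ?(leq_ltn_trans _ kn) // big_mkcond sum_words_top.
(* The term [r = 0] collects the words without the letter [k.+1]. *)
rewrite big_ord_recl /=; congr (_ + _).
  rewrite HpolyE ?(leq_ltn_trans _ kn) 1?ltnW // subn0 [RHS]big_mkcond.
  by apply: eq_bigr => v _; rewrite insertions0 big_seq1.
pose F r := insertion (n - r.+1) r.+1 (Hpoly R (n - r.+1) k).
rewrite big_add1 /= big_mkord (big_ord_widen n F); last by lia.
rewrite [RHS]big_mkcond; apply: eq_bigr => r _; rewrite /bump /= add1n.
(* The sum was padded with zeros up to [n]. Its true range is exactly where the parking bound on the
   new maximum [k.+1] holds for old words of length [n - r.+1]. *)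
have -> : (if (r < n - k.+1 + 1)%N then F r else 0)
    = \sum_(v <- words (n - r.+1) k | parking v)
        if (k < (n - r.+1).+1)%N then
          \sum_(w <- insertions k.+1 v r.+1) wt (tvar R) (uvar R) w else 0.
  case: ifP => rk; last first.
    by rewrite big1 // => v _; rewrite ifF //; lia.
  rewrite /F insertion_Hpoly; [|lia|lia]; apply: eq_bigr => v _.
  by rewrite ifT //; lia.
rewrite [RHS]big_mkcond big_seq [RHS]big_seq; apply: eq_bigr => v.
rewrite mem_words => /andP[/eqP sv vk].
rewrite -big_mkcond sum_parking_insertions //; last first.
  by apply: sub_all vk => a /andP[_]; rewrite ltnS.
by rewrite sv; case: (parking v).
Qed.
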